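(* Let $(X,d)$ and $(Y,\rho)$ be two complete metric spaces, let $\psi,\phi_1,\phi_2:(0,\infty)\to\mathbb{R}$ be functions, and let $T:X\times Y\to X$ and $S:X\times Y\to Y$ be two maps such that for all $z=(x,y)$, $w=(u,v)$ in $X\times Y$ with $\max\{d(T(x,y),T(u,v)),\rho(S(x,y),S(u,v))\}>0$, both $$\psi(d(Tz,Tw))\le\phi_1(\max\{d(x,u),\rho(y,v)\})\quad\text{and}\quad \psi(\rho(Sz,Sw))\le\phi_2(\max\{d(x,u),\rho(y,v)\})$$ hold. Suppose that: (i) $\psi$ is nondecreasing; (ii) $\phi_i(t)<\psi(t)$ for every $t>0$ and $i=1,2$; (iii) $\limsup_{t\to\epsilon+}\phi_i(t)<\psi(\epsilon+)$ for every $\epsilon>0$ and $i=1,2$. Then there exists a unique point $\xi^*=(x^*,y^* )\in X\times Y$ such that $x^*=T(x^*,y^* )$ and $y^*=S(x^*,y^* )$, and the sequences $x_n=T^n(x,y)$ and $y_n=S^n(x,y)$ converge to $x^*$ and $y^*$ respectively for any $(x,y)\in X\times Y$.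
   Context: For $z=(x,y)$, $Tz$ and $Sz$ mean $T(x,y)$ and $S(x,y)$. The iterates are defined by $T^1=T$, $S^1=S$, and for $n\ge2$, $T^n(x,y)=T\big(T^{n-1}(x,y),S^{n-1}(x,y)\big)$, $S^n(x,y)=S\big(T^{n-1}(x,y),S^{n-1}(x,y)\big)$. $\psi(\epsilon+)$ denotes the right-hand limit of $\psi$ at $\epsilon$. *)

(* Defs.v *)
From HB Require Import structures.
From mathcomp Require Import all_boot all_order all_algebra.
From mathcomp Require Import all_classical all_reals all_analysis.
Set Implicit Arguments.
Unset Strict Implicit.
Unset Printing Implicit Defensive.
Import Order.TTheory GRing.Theory Num.Theory.

(* [Complete] includes [Pointed]: these are the nonempty complete metric
   spaces, with distance [mdist]. *)
#[short(type="completeMetricType")]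
HB.structure Definition CompleteMetric (R : numDomainType) :=
  {M of Metric R M & Complete M}.

(* [Titer T S n] and [Siter T S n] are T^n and S^n, extended to n = 0 by the
   two projections. *)
Fixpoint Titer (X Y : Type) (T : X * Y -> X) (S : X * Y -> Y) (n : nat)
    (z : X * Y) : X :=
  if n is m.+1 then T (Titer T S m z, Siter T S m z) else z.1
with Siter (X Y : Type) (T : X * Y -> X) (S : X * Y -> Y) (n : nat)
    (z : X * Y) : Y :=
  if n is m.+1 then S (Titer T S m z, Siter T S m z) else z.2.

(* Main.v *)
(* Let f z = (T z, S z) act on X * Y with the max metric D.  Since psi is
   nondecreasing, phi_i < psi gives D (f z) (f w) < D z w for z <> w, and the
   limsup condition gives, for each e > 0, some d > 0 such that
   e < D z w < e + d implies D (f z) (f w) <= e: otherwise psi(e+) <=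
   psi (d(Tz, Tw)) <= phi1 (D z w) < psi(e+), and similarly for S.  This makes
   f a Ciric-Matkowski contraction of a complete metric space.  For such f,
   consecutive distances along an orbit tend to 0, and once one of them is below
   min d e the rest of the orbit stays within e + min d e of the current point. *)
Require Import Defs.
From HB Require Import structures.
From mathcomp Require Import all_boot all_order all_algebra.
From mathcomp Require Import all_classical all_reals all_analysis.
Set Implicit Arguments.
Unset Strict Implicit.
Unset Printing Implicit Defensive.
Import Order.TTheory GRing.Theory Num.Theory.
Import numFieldNormedType.Exports.
Local Open Scope classical_set_scope.
Local Open Scope ring_scope.

Section prod_complete.
Variables X Y : completeType.

HB.instance Definition _ := Pointed.on (X * Y)%type.

(** Both projections of a Cauchy filter are Cauchy, because an entourage of one factor pulls back to
    an entourage of the product; pairing their limits gives a limit of [F]. *)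
Lemma prod_cauchy_cvg (F : set_system (X * Y)) :
  ProperFilter F -> cauchy F -> cvg F.
Proof.
move=> FF Fc.
have c1 : cauchy (fst @ F).
  move=> A entA; have /Fc : entourage [set p : (X * Y) * (X * Y) | A (p.1.1, p.2.1)].
    exists (A, setT); first by split => //; exact: entourageT.
    by move=> [[a b] [c d]] /= [? _]; exists ((a, c), (b, d)).
  move=> [[U V] [FU FV] UVA]; exists (fst @` U, fst @` V).
    by split; [apply: filterS FU | apply: filterS FV] => x ?; exists x.
  by move=> [x y] /= [[u Uu <-] [v Vv <-]]; exact: (UVA (u, v)).
have c2 : cauchy (snd @ F).
  move=> A entA; have /Fc : entourage [set p : (X * Y) * (X * Y) | A (p.1.2, p.2.2)].
    exists (setT, A); first by split => //; exact: entourageT.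
    by move=> [[a b] [c d]] /= [_ ?]; exists ((a, c), (b, d)).
  move=> [[U V] [FU FV] UVA]; exists (snd @` U, snd @` V).
    by split; [apply: filterS FU | apply: filterS FV] => x ?; exists x.
  by move=> [x y] /= [[u Uu <-] [v Vv <-]]; exact: (UVA (u, v)).
apply/cvg_ex; exists (lim (fst @ F), lim (snd @ F)).
have l1 : fst @ F --> lim (fst @ F) by exact: cauchy_cvg.
have l2 : snd @ F --> lim (snd @ F) by exact: cauchy_cvg.
by have cF := cvg_pair l1 l2 => A /cF FA; apply: (@filterS _ F _ _ _ _ FA) => -[].
Qed.

HB.instance Definition _ := Uniform_isComplete.Build (X * Y)%type prod_cauchy_cvg.
End prod_complete.

Section prod_metric.
Variables (R : realFieldType) (X Y : metricType R).
Implicit Types z w : X * Y.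

(** The max is chosen because its balls are the product balls that [X * Y] already carries, so the
    metric fits the uniform structure shown complete above. *)
Let prod_mdist z w : R := Num.max (mdist z.1 w.1) (mdist z.2 w.2).

Let prod_mdist_ge0 z w : 0 <= prod_mdist z w.
Proof. by rewrite le_max mdist_ge0. Qed.

Let prod_mdist_positivity z w : prod_mdist z w = 0 -> z = w.
Proof.
case: z w => [x y] [u v] zw0; have: prod_mdist (x, y) (u, v) <= 0 by rewrite zw0.
rewrite ge_max => /andP[xu yv].
by congr (_, _); apply/mdist_positivity/le_anti; rewrite mdist_ge0 andbT.
Qed.

Let prod_ballEmdist z e : ball z e = [set w | prod_mdist z w < e].
Proof.
apply/seteqP; split => w; rewrite /ball /= /prod_ball !ballEmdist gt_max.
  by move=> [/= -> ->].
by move=> /andP.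
Qed.

HB.instance Definition _ := PseudoMetric_isMetric.Build R (X * Y)%type
  prod_mdist_ge0 prod_mdist_positivity prod_ballEmdist.

Lemma mdist_prodE z w :
  mdist z w = Num.max (mdist z.1 w.1) (mdist z.2 w.2).
Proof. by []. Qed.

End prod_metric.

HB.instance Definition _ (R : realFieldType) (X Y : completeMetricType R) :=
  Complete.on (X * Y)%type.

Section ciric_matkowski.
Variables (R : realType) (M : completeMetricType R) (f : M -> M).
Hypothesis f_strict : forall x y, x != y -> mdist (f x) (f y) < mdist x y.
Hypothesis f_cm : forall e, 0 < e -> exists2 d, 0 < d &
  forall x y, e < mdist x y -> mdist x y < e + d -> mdist (f x) (f y) <= e.

Let f_le x y : mdist (f x) (f y) <= mdist x y.
Proof. by have [->|/f_strict/ltW//] := eqVneq x y; rewrite !mdistxx. Qed.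

Let f_le_near e : 0 < e -> exists2 d, 0 < d &
  forall x y, mdist x y < e + d -> mdist (f x) (f y) <= e.
Proof.
move=> /f_cm[d d0 fd]; exists d => // x y xyd.
by have [/fd->//|xye] := ltP e (mdist x y); exact: le_trans xye.
Qed.

Let fix_unique x y : x = f x -> y = f y -> x = y.
Proof.
move=> xE yE; apply/eqP/negPn/negP => /f_strict.
by rewrite -xE -yE ltxx.
Qed.

(** Suppose the infimum [l] of the consecutive distances [t n] is positive. Some [t n] is below
    [l + d], so [t n.+1 <= l], and one more strict decrease gives [t n.+2 < l]. If the orbit has
    stopped instead, [t n.+1 = 0 < l]. *)
Let step_small z e : 0 < e -> exists n, mdist (iter n f z) (iter n.+1 f z) < e.
Proof.
move=> e0; pose t n := mdist (iter n f z) (iter n.+1 f z).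
pose l := inf (range t).
have t_inf : has_inf (range t).
  by split; [exists (t 0%N), 0%N | exists 0 => _ [n _ <-]; exact: mdist_ge0].
have lt n : l <= t n by apply: ge_inf; [case: t_inf|exists n].
have [l0|l0] := ltP 0 l; last first.
  have /(inf_lt t_inf.1)[_ [n _ <-] ?] : l < e by exact: le_lt_trans e0.
  by exists n.
have [d d0 fd] := f_le_near l0.
have /(inf_lt t_inf.1)[_ [n _ <-] /fd tl] : l < l + d by rewrite ltrDl.
have [E|/f_strict tlt] := eqVneq (iter n.+1 f z) (iter n.+2 f z).
  have := lt n.+1; rewrite /t E mdistxx => /(lt_le_trans l0).
  by rewrite ltxx.
by have := lt_le_trans tlt (le_trans tl (lt n.+2)); rewrite ltxx.
Qed.

Let iter_cvg z : cvg (iter n f z @[n --> \oo]).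
Proof.
apply/cauchy_cvgP/cauchy_exP => e e0.
have e20 : 0 < e / 2 by rewrite divr_gt0.
have [d d0 fd] := f_le_near e20.
have m0 : 0 < Num.min d (e / 2) by rewrite lt_min d0.
have [N] := step_small z m0; rewrite lt_min => /andP[Nd Ne].
(* This radius is invariant: being at most [e / 2 + d], it is brought down to [e / 2] by [f], and
   the step from [iter N f z] to [iter N.+1 f z] adds less than the minimum. It is also at most
   [e]. *)
have close k : mdist (iter N f z) (iter (N + k)%N f z) < e / 2 + Num.min d (e / 2).
  elim: k => [|k IH]; first by rewrite addn0 mdistxx addr_gt0.
  rewrite addnS addrC (le_lt_trans (metric_triangle _ (iter N.+1 f z) _))//.
  rewrite ltr_leD ?lt_min ?Nd//= fd//.
  by rewrite (lt_le_trans IH)// lerD2l ge_min lexx.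
exists (iter N f z); exists N => // n /= Nn.
rewrite ballEmdist/= -(subnKC Nn) (lt_le_trans (close _))//.
by rewrite [leRHS]splitr lerD2l ge_min lexx orbT.
Qed.

(** The shifted orbit tends to [p], and also to [f p] because [f] is nonexpansive; limits in a
    metric space are unique. *)
Let iter_cvg_fix z : let p := lim (iter n f z @[n --> \oo]) in p = f p.
Proof.
move=> p; have zp : iter n f z @[n --> \oo] --> p by exact: iter_cvg.
have zp1 : iter n.+1 f z @[n --> \oo] --> p.
  by under eq_fun do rewrite -addn1; exact: cvg_comp (cvg_addnr 1) zp.
apply: cvg_unique zp1 _; first exact: metric_hausdorff.
apply/cvg_ballP => e e0.
apply: filterS (cvg_ball zp e0) => n; rewrite !ballEmdist/=.
exact: le_lt_trans.
Qed.

Lemma ciric_matkowski_fixpoint : exists p,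
  unique (fun x => x = f x) p /\ forall z, iter n f z @[n --> \oo] --> p.
Proof.
pose p := lim (iter n f point @[n --> \oo]).
exists p; split; first by split=> [|x]; [|apply: fix_unique]; exact: iter_cvg_fix.
move=> z; rewrite /p (fix_unique (iter_cvg_fix point) (iter_cvg_fix z)).
exact: iter_cvg.
Qed.

End ciric_matkowski.

Section right_limits.
Variable R : realType.
Implicit Types psi phi : R -> R.

(** By monotonicity the right limit exists and is the infimum of [psi] over []e, +oo[], bounded
    below by [psi e]. *)
Lemma lim_at_right_le psi e s :
  0 < e -> e < s -> {in `]0, +oo[ &, {homo psi : s t / s <= t}} ->
  lim (psi t @[t --> e^'+]) <= psi s.
Proof.
move=> e0 es psi_nd.
have pos x : e < x -> x \in `]0, +oo[ by rewrite in_itv/= andbT; exact: lt_trans.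
have lb : has_lbound [set psi x | x in [set` `]e, +oo[]].
  exists (psi e) => _ [x /= + <-]; rewrite in_itv/= andbT => ex.
  by apply: psi_nd (pos _ ex) (ltW ex); rewrite in_itv/= e0.
have /cvg_lim -> // : psi t @[t --> e^'+] --> inf [set psi x | x in [set` `]e, +oo[]].
  apply: nondecreasing_at_right_cvgr => // x y; rewrite !in_itv/= !andbT.
  by move=> /pos ? /pos ?; exact: psi_nd.
by apply: ge_inf => //; exists s => //=; rewrite in_itv/= es.
Qed.

(** The limsup is an infimum of suprema over right neighbourhoods of [e], so one of these suprema is
    already below [l]. *)
Lemma limf_esup_at_right_lt phi e (l : R) :
  (limf_esup (EFin \o phi) e^'+ < l%:E)%E ->
  exists2 d, 0 < d & forall t, e < t -> t < e + d -> phi t < l.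
Proof.
move=> /ereal_inf_lt[_ [V eV <-] Vl].
have [d d0 dV] := eV; exists d => // t et ted.
rewrite -lte_fin (le_lt_trans _ Vl)//; apply: ereal_sup_ubound; exists t => //.
apply: dV => //=; rewrite ltr_distlC; apply/andP; split => //.
by rewrite ltrBlDr (lt_trans et)// ltrDl.
Qed.

End right_limits.

(* psi, phi1, phi2 are total functions on R whose values off ]0, +oo[ are never
   used: each contraction inequality is required when its left-hand side is
   defined, that is, when the distance to which psi is applied is positive. *)
Theorem theorem3p3 (R : realType) (X Y : completeMetricType R)
    (psi phi1 phi2 : R -> R) (T : X * Y -> X) (S : X * Y -> Y)
    (contr : forall z w : X * Y,
      0 < Num.max (mdist (T z) (T w)) (mdist (S z) (S w)) ->
      (0 < mdist (T z) (T w) ->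
        psi (mdist (T z) (T w)) <=
        phi1 (Num.max (mdist z.1 w.1) (mdist z.2 w.2))) /\
      (0 < mdist (S z) (S w) ->
        psi (mdist (S z) (S w)) <=
        phi2 (Num.max (mdist z.1 w.1) (mdist z.2 w.2))))
    (psi_nd : {in `]0, +oo[ &, {homo psi : s t / s <= t}})
    (phi_lt : forall t : R, 0 < t -> phi1 t < psi t /\ phi2 t < psi t)
    (phi_limsup : forall e : R, 0 < e ->
      (limf_esup (EFin \o phi1) e^'+ < (lim (psi t @[t --> e^'+]))%:E)%E /\
      (limf_esup (EFin \o phi2) e^'+ < (lim (psi t @[t --> e^'+]))%:E)%E) :
  exists xi : X * Y,
    unique (fun zeta : X * Y => zeta.1 = T zeta /\ zeta.2 = S zeta) xi /\
    forall z : X * Y,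
      Titer T S n z @[n --> \oo] --> xi.1 /\
      Siter T S n z @[n --> \oo] --> xi.2.
Proof.
have contrT z w : 0 < mdist (T z) (T w) ->
    psi (mdist (T z) (T w)) <= phi1 (mdist z w).
  by move=> Tzw; apply: (contr z w _).1; rewrite // lt_max Tzw.
have contrS z w : 0 < mdist (S z) (S w) ->
    psi (mdist (S z) (S w)) <= phi2 (mdist z w).
  by move=> Szw; apply: (contr z w _).2; rewrite // lt_max Szw orbT.
(* Here [a] stands for the distance of the images under [T] or [S]. The contraction says nothing
   when [a] is not positive, but then the bound is immediate. *)
have lt_dist (phi : R -> R) (a t : R) : 0 < t -> phi t < psi t ->
    (0 < a -> psi a <= phi t) -> a < t.
  move=> t0 phit ha; have [a0|] := ltP 0 a; last by move=> /le_lt_trans; exact.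
  rewrite ltNge; apply/negP => ta.
  have := le_lt_trans (ha a0) phit; rewrite ltNge => /negP; apply.
  by apply: psi_nd; rewrite // in_itv/= ?t0 ?a0.
have le_dist (phi : R -> R) (a t e : R) : 0 < e -> phi t < lim (psi t @[t --> e^'+]) ->
    (0 < a -> psi a <= phi t) -> a <= e.
  move=> e0 phit ha; rewrite leNgt; apply/negP => ea.
  have := le_lt_trans (ha (lt_trans e0 ea)) phit; rewrite ltNge => /negP; apply.
  exact: lim_at_right_le.
pose f z := (T z, S z).
have [||p [[pE p_unique] f_cvg]] := @ciric_matkowski_fixpoint R (X * Y)%type f.
- move=> z w; rewrite -mdist_gt0 => zw0.
  rewrite mdist_prodE gt_max.
  have [phi1D phi2D] := phi_lt _ zw0.
  apply/andP; split; first exact: lt_dist zw0 phi1D (contrT z w).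
  exact: lt_dist zw0 phi2D (contrS z w).
- move=> e e0.
  have [/limf_esup_at_right_lt[d1 d10 hd1] /limf_esup_at_right_lt[d2 d20 hd2]] :=
    phi_limsup _ e0.
  exists (Num.min d1 d2); first by rewrite lt_min d10.
  move=> z w ezw; rewrite -ltrBlDl lt_min !ltrBlDl => /andP[zw1 zw2].
  rewrite mdist_prodE ge_max; apply/andP; split.
    exact: le_dist e0 (hd1 _ ezw zw1) (contrT z w).
  exact: le_dist e0 (hd2 _ ezw zw2) (contrS z w).
have iterE n z : iter n f z = (Titer T S n z, Siter T S n z).
  by elim: n => [|n IH]; [case: z | rewrite iterS IH].
exists p; split.
  split=> [|z [zT zS]]; first by split; rewrite {1}pE.
  by apply: p_unique; rewrite [LHS]surjective_pairing zT zS.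
move=> z; have := f_cvg z; under eq_fun do rewrite iterE.
(* A ball of the product is a product of balls, so convergence splits into coordinates. *)
move=> /cvg_ball pz; split; apply/cvg_ballP => e /pz.
- by apply: filterS => n [].
- by apply: filterS => n [].
Qed.
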